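(* All cactus graphs satisfy the strong bunkbed conjecture.
   Context: All graphs are finite and simple; an edge between $v$ and $w$ is written $vw=\{v,w\}$. Bunkbed graph: for a graph $G$, $B(G)$ has vertex set $V(G)\times\{0,1\}$; write $v_i=(v,i)$ and, for $e=xy\in E(G)$, $e_i=x_iy_i$. Its edges are the horizontal edges $e_i$ ($e\in E(G)$, $i\in\{0,1\}$) and the posts $v_0v_1$ ($v\in V(G)$). Percolation: for $T\subseteq V(G)$ and $\vec p=(p_e)_{e\in E(G)}\in[0,1]^{E(G)}$, $B^T=B^T(G,\vec p)$ is the random subgraph of $B(G)$ containing all vertices of $B(G)$, in which each horizontal edge $e_i$ is present with probability $p_e$, independently of all other horizontal edges, and each post $v_0v_1$ is deterministically present if and only if $v\in T$. Write $a\overset{B^T}{\longleftrightarrow}b$ if there is a path between $a$ and $b$ in $B^T$. For $v,w\in V(G)$, $\mathscr B(G,T,\vec p,v,w)$ denotes the statement $\mathbb P(v_0\overset{B^T}{\longleftrightarrow}w_0)\ge\mathbb P(v_0\overset{B^T}{\longleftrightarrow}w_1)$. $G$ satisfies the strong bunkbed conjecture if $\mathscr B(G,T,\vec p,v,w)$ holds for all $T\subseteq V(G)$, $\vec p\in[0,1]^{E(G)}$, $v,w\in V(G)$. Cactus: a cycle in $G$ is a (not necessarily induced) subgraph of $G$ isomorphic to a cycle graph $C_n$ with $n\ge3$. A graph $G$ is a cactus graph if $G$ is connected and any two cycles $C\ne\widetilde C$ in $G$ satisfy $|V(C)\cap V(\widetilde C)|\le1$. *)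

(* Defs.v *)
From HB Require Import structures.
From mathcomp Require Import all_boot all_order all_algebra reals.

Set Implicit Arguments.
Unset Strict Implicit.
Unset Printing Implicit Defensive.

Import Order.TTheory GRing.Theory Num.Theory.

Local Open Scope ring_scope.

(* Finite simple graphs; the edge vw is the two-element set {v, w}. *)
Record sgraph := SGraph {
  vertex :> finType;
  edges : {set {set vertex}};
  edges_card2 : forall e, e \in edges -> #|e| = 2%N }.

Definition adj (V : finType) (F : {set {set V}}) : rel V :=
  fun x y => [set x; y] \in F.

Definition reachable (V : finType) (F : {set {set V}}) (x y : V) : bool :=
  connect (adj F) x y.

Definition connected_graph (G : sgraph) : Prop :=
  forall x y : G, reachable (edges G) x y.

(* [ordS i] is i + 1 modulo n; this is the edge set of C_n when 3 <= n. *)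
Definition cycle_edges (n : nat) : {set {set 'I_n}} :=
  [set [set i; ordS i] | i : 'I_n].

(* A subgraph is a pair (vertex set, edge set); f is an isomorphism from C_n
   onto the subgraph C. *)
Definition is_cycle (G : sgraph) (C : {set G} * {set {set G}}) : Prop :=
  C.2 \subset edges G /\
  exists (n : nat) (f : 'I_n -> G),
    [/\ (3 <= n)%N, injective f, C.1 = [set f i | i : 'I_n]
      & C.2 = [set f @: (e : {set 'I_n}) | e in cycle_edges n]].

Definition cactus (G : sgraph) : Prop :=
  connected_graph G /\
  forall C D : {set G} * {set {set G}},
    is_cycle C -> is_cycle D -> C <> D -> (#|C.1 :&: D.1| <= 1)%N.

(* Levels 0 and 1 are encoded as false and true. *)
Definition hedge (V : finType) (e : {set V}) (i : bool) : {set V * bool} :=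
  [set (x, i) | x in e].

Definition post (V : finType) (v : V) : {set V * bool} :=
  [set (v, false); (v, true)].

Definition bunkbed_edges (G : sgraph) : {set {set G * bool}} :=
  [set hedge e i | e in edges G, i in [set: bool]] :|: [set post v | v : G].

Lemma bunkbed_edges_card2 (G : sgraph) (f : {set G * bool}) :
  f \in bunkbed_edges G -> #|f| = 2%N.
Proof.
case/setUP => [/imset2P[e i eG _ ->] | /imsetP[v _ ->]].
  by rewrite card_imset ?(edges_card2 eG) // => x y [].
by rewrite cards2 xpair_eqE eqxx.
Qed.

Definition bunkbed (G : sgraph) : sgraph :=
  @SGraph (G * bool)%type (bunkbed_edges G) (@bunkbed_edges_card2 G).

(* The probability that the edge set of B^T is exactly S, for S a set of
   edges of B(G).  Only the values of p on edges of G matter. *)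
Definition percolation_law (R : realType) (G : sgraph) (T : {set G})
    (p : {set G} -> R) (S : {set {set bunkbed G}}) : R :=
  if [forall v : G, (post v \in S) == (v \in T)] then
    \prod_(e in edges G) \prod_(i : bool)
      (if hedge e i \in S then p e else 1 - p e)
  else 0.

Definition prob_connected (R : realType) (G : sgraph) (T : {set G})
    (p : {set G} -> R) (a b : bunkbed G) : R :=
  \sum_(S in powerset (edges (bunkbed G)) | reachable S a b)
    percolation_law T p S.

Definition bunkbed_statement (R : realType) (G : sgraph) (T : {set G})
    (p : {set G} -> R) (v w : G) : Prop :=
  prob_connected T p (v, false) (w, false)
    >= prob_connected T p (v, false) (w, true).

Definition strong_bunkbed (R : realType) (G : sgraph) : Prop :=
  forall (T : {set G}) (p : {set G} -> R) (v w : G),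
    (forall e, e \in edges G -> 0 <= p e <= 1) ->
    bunkbed_statement T p v w.

(* Main.v *)
(* For posts T, let d(v, w) be P(v_0 <-> w_0) - P(v_0 <-> w_1), where the
   horizontal edges used are the copies of those in F; we show d >= 0 by
   induction on the number of edges of F, over all T, v and w.

   If F = F1 + F2 is glued at a single vertex u, then d is a mixture of the
   values for F1 with posts T or T + u (when v, w both lie in F1), or the product
   d_F1(v, u) d_F2(u, w) (when they lie on opposite sides).  Otherwise F is
   empty, a single edge or a single cycle, so all degrees are at most 2.  If T separates
   v from w, swapping the two levels beyond T shows that d = 0.  If it does
   not, there is a path A from v to w whose inner vertices avoid T and meet no
   edge outside A.  When A is open at one of the levels, the configuration and
   its full reflection together contribute a nonnegative amount to d; when A is
   broken at both levels it is irrelevant to the connections of v and w, and the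
   induction hypothesis for F - A applies. *)
Require Import Defs.
From mathcomp Require Import all_boot all_order all_algebra reals.

Set Implicit Arguments.
Unset Strict Implicit.
Unset Printing Implicit Defensive.

Import Order.TTheory GRing.Theory Num.Theory.

Local Open Scope ring_scope.

(** * Expectations over random subsets *)

Section Expectation.
Variables (R : realFieldType) (I : finType) (q : I -> R).
Implicit Types (H A : {set I}) (f : {set I} -> R).

Definition wt H A : R := \prod_(i in H) (if i \in A then q i else 1 - q i).

Definition Ex H f : R := \sum_(A : {set I} | A \subset H) wt H A * f A.

Lemma eq_Ex H f g : (forall A, A \subset H -> f A = g A) -> Ex H f = Ex H g.
Proof. by move=> fg; apply: eq_bigr => A /fg ->. Qed.

Lemma ExD H f g : Ex H (fun A => f A + g A) = Ex H f + Ex H g.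
Proof. by rewrite -big_split; apply: eq_bigr => A _; rewrite mulrDr. Qed.

Lemma ExMr H f c : Ex H (fun A => f A * c) = Ex H f * c.
Proof. by rewrite mulr_suml; apply: eq_bigr => A _; rewrite mulrA. Qed.

Lemma ExN H f : Ex H (fun A => - f A) = - Ex H f.
Proof. by rewrite -sumrN; apply: eq_bigr => A _; rewrite mulrN. Qed.

Lemma Ex_ge0 H f : (forall i, i \in H -> 0 <= q i <= 1) ->
  (forall A, A \subset H -> 0 <= f A) -> 0 <= Ex H f.
Proof.
move=> q01 f0; apply: sumr_ge0 => A AH; rewrite mulr_ge0 ?f0 //.
by apply: prodr_ge0 => i /q01/andP[? ?]; case: ifP; rewrite ?subr_ge0.
Qed.

(** Fubini for independent parts: [A] corresponds to the pair of its traces on [H1] and [H2], and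
    the weight factors accordingly. *)
Lemma ExU H1 H2 f : [disjoint H1 & H2] ->
  Ex (H1 :|: H2) f = Ex H1 (fun A1 => Ex H2 (fun A2 => f (A1 :|: A2))).
Proof.
move=> dH; have [s1 s2] := (subsetUl H1 H2, subsetUr H1 H2).
have tr A1 A2 : A1 \subset H1 -> A2 \subset H2 ->
    (A1 :|: A2) :&: H1 = A1 /\ (A1 :|: A2) :&: H2 = A2.
  move=> s11 s22; rewrite !setIUl (setIidPl s11) (setIidPl s22).
  have -> : A2 :&: H1 = set0.
    by apply/disjoint_setI0; rewrite disjoint_sym (disjointWr s22).
  have -> : A1 :&: H2 = set0 by apply/disjoint_setI0; rewrite (disjointWl s11).
  by rewrite setU0 set0U.
under [RHS]eq_bigr => A1 _ do rewrite mulr_sumr.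
rewrite pair_big_dep /=.
rewrite (reindex_onto (fun A => (A :&: H1, A :&: H2))
           (fun B : {set I} * {set I} => B.1 :|: B.2)) /=; last first.
  by case=> A1 A2 /andP[/= ? ?]; have [| | -> ->] := tr A1 A2.
apply: eq_big => [A | A AH].
  by rewrite !subsetIr /= -setIUr; apply/setIidPl/eqP.
rewrite -setIUr (setIidPl AH) mulrA; congr (_ * _).
rewrite /wt (eq_bigl [predU H1 & H2]) => [|i]; last by rewrite !inE.
rewrite bigU //=; congr (_ * _).
  by apply: eq_bigr => i iH; rewrite inE iH andbT.
by apply: eq_bigr => i iH; rewrite inE iH andbT.
Qed.

(** An involution that preserves [H] and [q] permutes the subsets of [H] and preserves their
    weights. *)
Lemma Ex_reindex H (g : I -> I) f : involutive g ->
  (forall i, (g i \in H) = (i \in H)) -> (forall i, q (g i) = q i) ->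
  Ex H (fun A => f (g @^-1: A)) = Ex H f.
Proof.
move=> gK gH gq; have gg : involutive (fun A : {set I} => g @^-1: A).
  by move=> A; apply/setP => i; rewrite !inE gK.
rewrite [RHS](reindex_inj (can_inj gg)) /=; apply: eq_big => [A | A _].
  apply/subsetP/subsetP => s i.
    by rewrite inE => /s; rewrite gH.
  by move=> iA; rewrite -gH s // inE gK.
congr (_ * _); rewrite /wt (reindex_inj (can_inj gK)).
by apply: eq_big => [i | i _]; rewrite ?gH // inE gq.
Qed.

End Expectation.

(** * Reflections of configurations *)

Section Percolation.
Variables (V : finType).
Implicit Types (F : {set {set V}}) (T U : {set V}) (w : {set {set V} * bool}).
Implicit Types (a b c : V * bool) (x y z u v : V).

(* A configuration [w] lists the open horizontal edges, [(e, i)] standing for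
   the copy of [e] at level [i]. *)
Definition step T w a b : bool :=
  ((a.2 == b.2) && (([set a.1; b.1], a.2) \in w)) ||
  [&& a.1 == b.1, a.2 != b.2 & a.1 \in T].

Definition conn T w := connect (step T w).

Lemma step_sym T w : symmetric (step T w).
Proof.
move=> a b; rewrite /step setUC eq_sym [a.1 == _]eq_sym.
by case: eqP => [->|] //=; case: eqP => [->|].
Qed.

Lemma conn_sym T w a b : conn T w a b = conn T w b a.
Proof. exact/sym_connect_sym/step_sym. Qed.

Lemma conn_trans T w a b c : conn T w a b -> conn T w b c -> conn T w a c.
Proof. exact: connect_trans. Qed.

Lemma conn_eql T w a b c : conn T w a b -> conn T w a c = conn T w b c.
Proof.
by move=> ab; apply/idP/idP; apply: conn_trans; rewrite // conn_sym.
Qed.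

Lemma conn_eqr T w a b c : conn T w b c -> conn T w a b = conn T w a c.
Proof. by move=> /(conn_eql a); rewrite 2![conn _ _ a _]conn_sym. Qed.

Lemma conn_homo T w T' w' (h : V * bool -> V * bool) :
  (forall a b, step T w a b -> conn T' w' (h a) (h b)) ->
  forall a b, conn T w a b -> conn T' w' (h a) (h b).
Proof.
move=> hP a b /connectP[p]; elim: p a => [|c p IH] a /=.
  by move=> _ ->; apply: connect0.
by case/andP=> /hP ac pc lb; apply: conn_trans ac (IH _ pc lb).
Qed.

Lemma conn_closed T w (P : pred (V * bool)) :
  (forall a b, step T w a b -> P a -> P b) ->
  forall a b, conn T w a b -> P a -> P b.
Proof.
move=> hP a b /connectP[p]; elim: p a => [|c p IH] a /=; first by move=> _ ->.
by case/andP=> /hP ac pc lb /ac; apply: IH.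
Qed.

Lemma conn_post T w x : x \in T -> conn T w (x, false) (x, true).
Proof. by move=> xT; apply: connect1; rewrite /step /= eqxx xT. Qed.

Lemma conn_post_eq T w x i j : x \in T -> conn T w (x, i) (x, j).
Proof.
move=> xT; case: i j => [] []; rewrite ?conn_post //; try exact: connect0.
by rewrite conn_sym conn_post.
Qed.

Definition lift (H : {set {set V}}) : {set {set V} * bool} := setX H [set: bool].

Lemma in_lift H e i : ((e, i) \in lift H) = (e \in H).
Proof. by rewrite !inE andbT. Qed.

(* Swaps the levels of the edges disjoint from [U]; on vertices this amounts to
   swapping the levels outside [U], up to posts. *)
Definition flip_edge U (ei : {set V} * bool) : {set V} * bool :=
  (ei.1, ei.2 (+) [disjoint ei.1 & U]).

Definition flip U w := flip_edge U @^-1: w.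

Definition flip_vertex U a : V * bool := (a.1, a.2 (+) (a.1 \notin U)).

Lemma flip_edgeK U : involutive (flip_edge U).
Proof. by case=> e i; rewrite /flip_edge /= addbK. Qed.

Lemma flip_vertexK U : involutive (flip_vertex U).
Proof. by case=> e i; rewrite /flip_vertex /= addbK. Qed.

Lemma flipK U : involutive (flip U).
Proof. by move=> w; apply/setP=> ei; rewrite !inE flip_edgeK. Qed.

Definition boundary_in F U T :=
  forall x y, [set x; y] \in F -> x \in U -> y \notin U -> y \in T.

Lemma flip_sub F U w : (flip U w \subset lift F) = (w \subset lift F).
Proof.
have sub w' : w' \subset lift F -> flip U w' \subset lift F.
  move=> /subsetP s; apply/subsetP => -[e i]; rewrite inE => /s.
  by rewrite !in_lift.
by apply/idP/idP => /sub //; rewrite flipK.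
Qed.

Lemma disjoint2 x y U : [disjoint [set x; y] & U] = (x \notin U) && (y \notin U).
Proof. by rewrite disjoints_subset subUset !sub1set !inE. Qed.

(** The only edges not carried along by [flip_vertex] are those leaving [U]: they keep their level
    while their outer end changes it. That end carries a post, so its two copies are connected
    anyway. *)
Lemma conn_flip F U T w a b : w \subset lift F -> boundary_in F U T ->
  conn T (flip U w) (flip_vertex U a) (flip_vertex U b) = conn T w a b.
Proof.
move=> wF bF.
have main w' : w' \subset lift F -> forall a b, conn T w' a b ->
    conn T (flip U w') (flip_vertex U a) (flip_vertex U b).
  move=> /subsetP w'F; apply: conn_homo => -[x i] [y j] /=.
  case/orP=> /= [/andP[/eqP<- xy] | /and3P[/eqP<- ij xT]]; last first.
    exact: conn_post_eq.
  have xyF : [set x; y] \in F by rewrite -(in_lift _ _ i) w'F.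
  rewrite /flip_vertex /=.
  have st k : ([set x; y], k (+) [disjoint [set x; y] & U]) \in w' ->
      conn T (flip U w') (x, k) (y, k).
    by move=> h; apply: connect1; rewrite /step /= eqxx inE h.
  rewrite disjoint2 in st.
  have [xU | xU] := boolP (x \in U); have [yU | yU] := boolP (y \in U) => /=.
  - by apply: st; rewrite xU /= addbF addbF.
  - apply: conn_trans (conn_post_eq _ _ _ (bF _ _ xyF xU yU)).
    by apply: st; rewrite xU !addbF.
  - rewrite setUC in xyF; apply: conn_trans (conn_post_eq _ _ _ (bF _ _ xyF yU xU)) _.
    by apply: st; rewrite yU andbF !addbF.
  - by apply: st; rewrite xU yU /= addbK.
apply/idP/idP; last exact: main.
by move/main; rewrite flip_sub flipK !flip_vertexK; apply.
Qed.

(** * The gap between the two levels, and its vanishing by reflection *)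

Section Difference.
Variables (R : realFieldType) (p : {set V} -> R).

Definition diff T w v x : R :=
  (conn T w (v, false) (x, false))%:R - (conn T w (v, false) (x, true))%:R.

Definition law (ei : {set V} * bool) : R := p ei.1.

(** This is the quantity d(v, x) of the overview. *)
Definition gap F T v x : R := Ex law (lift F) (fun w => diff T w v x).

(** Both copies of an edge are open with the same probability, so exchanging them preserves the
    law. *)
Lemma Ex_flip F U (f : {set {set V} * bool} -> R) :
  Ex law (lift F) (fun w => f (flip U w)) = Ex law (lift F) f.
Proof.
apply: Ex_reindex; first exact: flip_edgeK.
  by case=> e i; rewrite !in_lift.
by case.
Qed.

Lemma Ex_anti F U (f : {set {set V} * bool} -> R) :
  (forall w, w \subset lift F -> f (flip U w) = - f w) ->
  Ex law (lift F) f = 0.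
Proof.
move=> fN; apply/eqP; rewrite -[_ == 0](mulrn_eq0 _ 2) mulr2n.
by rewrite -{1}(Ex_flip F U) (eq_Ex _ fN) ExN addNr.
Qed.

(** Flipping beyond [U] fixes v_0 and exchanges x_0 with x_1, hence negates [diff]. *)
Lemma gap_separated F U T v x :
  boundary_in F U T -> v \in U -> x \notin U -> gap F T v x = 0.
Proof.
move=> bF vU xU; apply: (@Ex_anti _ U) => w wF.
have vE : flip_vertex U (v, false) = (v, false) by rewrite /flip_vertex vU.
have xE i : flip_vertex U (x, i) = (x, ~~ i) by rewrite /flip_vertex /= xU addbT.
have cE i : conn T (flip U w) (v, false) (x, i) = conn T w (v, false) (x, ~~ i).
  by have := conn_flip (v, false) (x, ~~ i) wF bF; rewrite vE xE negbK.
by rewrite /diff !cE opprB.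
Qed.

Lemma conn_flip0 F T w x i y j : w \subset lift F ->
  conn T (flip set0 w) (x, i) (y, j) = conn T w (x, ~~ i) (y, ~~ j).
Proof.
move=> wF; have E k z : (z, k) = flip_vertex set0 (z, ~~ k).
  by rewrite /flip_vertex inE addbT /= negbK.
rewrite (E i x) (E j y); apply: conn_flip wF _.
by move=> ? ?; rewrite inE.
Qed.

Lemma gap_post F T v x : v \in T -> gap F T v x = 0.
Proof.
move=> vT; apply: (@Ex_anti _ set0) => w wF.
rewrite /diff !(conn_flip0 _ _ _ _ _ wF) /=.
by rewrite !(conn_eql _ (conn_post_eq _ true false vT)) opprB.
Qed.

End Difference.
End Percolation.

(** * Gluing at a vertex *)

Section Gluing.
Variables (V : finType).
Implicit Types (F : {set {set V}}) (T : {set V}) (w : {set {set V} * bool}).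
Implicit Types (x y z u v : V).

(** The two sides cover all vertices, isolated ones included, so that any two vertices lie on the
    same side or on opposite sides. *)
Definition glued (V1 V2 : {set V}) u F1 F2 :=
  [/\ V1 :|: V2 = setT, V1 :&: V2 = [set u],
      forall e, e \in F1 -> e \subset V1 & forall e, e \in F2 -> e \subset V2].

Lemma gluedC V1 V2 u F1 F2 : glued V1 V2 u F1 F2 -> glued V2 V1 u F2 F1.
Proof. by case; rewrite setUC setIC. Qed.

Lemma glued_cut V1 V2 u F1 F2 x : glued V1 V2 u F1 F2 ->
  x \in V1 -> x \in V2 -> x = u.
Proof. by case=> _ I12 _ _ x1 x2; apply/set1P; rewrite -I12 inE x1. Qed.

Lemma in_glued V1 V2 u F1 F2 x : glued V1 V2 u F1 F2 -> x \notin V1 -> x \in V2.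
Proof.
by case=> U12 _ _ _; have := in_setT x; rewrite -U12 inE => /orP[->|].
Qed.

Lemma cut_glued V1 V2 u F1 F2 : glued V1 V2 u F1 F2 -> (u \in V1) && (u \in V2).
Proof. by case=> _ I12 _ _; rewrite -in_setI I12 set11. Qed.

Definition add_post T w u := if conn T w (u, false) (u, true) then u |: T else T.

Lemma stepUl T w1 w2 a b : step T w1 a b -> step T (w1 :|: w2) a b.
Proof.
case/orP=> [/andP[ij h] | h]; apply/orP; last by right.
by left; rewrite ij inE h.
Qed.

Lemma connUl T w1 w2 a b : conn T w1 a b -> conn T (w1 :|: w2) a b.
Proof. by apply: (@conn_homo _ _ _ _ _ id) => c d /stepUl h; apply: connect1. Qed.

Lemma connUr T w1 w2 a b : conn T w2 a b -> conn T (w1 :|: w2) a b.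
Proof. by rewrite setUC; apply: connUl. Qed.

(** An excursion out of [V1] leaves and returns through copies of [u]. Its only possible effect is
    to join u_0 to u_1, which is what a post at [u] does. *)
Lemma conn_glued V1 V2 u F1 F2 T w1 w2 x y i j : glued V1 V2 u F1 F2 ->
  w1 \subset lift F1 -> w2 \subset lift F2 -> x \in V1 -> y \in V1 ->
  conn T (w1 :|: w2) (x, i) (y, j) = conn (add_post T w2 u) w1 (x, i) (y, j).
Proof.
move=> gl /subsetP s1 /subsetP s2 xV yV; apply/idP/idP; last first.
  apply: (@conn_homo _ _ _ _ _ id) => -[a k] [b l] /=.
  rewrite /add_post; case: ifP => [uu | _]; last first.
    by move/stepUl => h; apply: connect1.
  case/orP=> [h|/and3P[/= /eqP <- kl]]; first by apply/connect1/stepUl/orP; left.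
  rewrite in_setU1 => /orP[/eqP -> | aT]; last exact: conn_post_eq.
  have {}uu : conn T (w1 :|: w2) (u, false) (u, true) by apply: connUr.
  by case: k l {kl} => [] [] //=; rewrite ?[conn _ _ _ _]connect0 // conn_sym.
(* [h] collapses the far side onto the copies of [u], pieces not connected to
   [u] going to [(u, false)]. *)
pose h a := if a.1 \in V1 then a else (u, conn T w2 a (u, true)).
have hx k z : z \in V1 -> h (z, k) = (z, k) by rewrite /h /= => ->.
rewrite -{2}(hx i x xV) -{2}(hx j y yV).
have heq a b : a.1 \notin V1 -> b.1 \notin V1 -> conn T w2 a b -> h a = h b.
  by rewrite /h => /negbTE-> /negbTE-> /(conn_eql (u, true)) ->.
have sub c : c \in T -> c \in add_post T w2 u.
  by rewrite /add_post; case: ifP => // _ cT; rewrite inE cT orbT.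
(* Entering the far side from u_1 stays at u_1 after collapsing. Entering from u_0 lands on u_1
   exactly when [w2] joins the two copies, and then the added post is available. *)
have cross k b : b \notin V1 -> conn T w2 (u, k) (b, k) ->
    conn (add_post T w2 u) w1 (h (u, k)) (h (b, k)).
  move=> bV ub; rewrite (hx k u); last by case/andP: (cut_glued gl).
  rewrite /h /= (negbTE bV) conn_sym -(conn_eql _ ub).
  case: k {ub} => /=; first by rewrite /conn !connect0.
  case: (boolP (conn T w2 _ _)) => uu; last exact: connect0.
  rewrite conn_sym; apply: conn_post.
  by rewrite /add_post uu setU11.
apply: conn_homo => -[a k] [b l]; rewrite {1}/step /= inE.
case/orP=> [/andP[/eqP<-{l} /orP[]] ab | /and3P[/eqP<- kl aT]]; last first.
- have [aV|aV] := boolP (a \in V1); last first.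
    rewrite (heq (a, k) (a, l)) //; first exact: connect0.
    exact: conn_post_eq.
  by rewrite !hx //; apply/conn_post_eq/sub.
- have /subsetP abV : [set a; b] \subset V2.
    by case: gl => _ _ _; apply; rewrite -(in_lift _ _ k) s2.
  have [aV2 bV2] := (abV a (set21 a b), abV b (set22 a b)).
  have cab : conn T w2 (a, k) (b, k) by apply: connect1; rewrite /step /= eqxx ab.
  have [aV|aV] := boolP (a \in V1); have [bV|bV] := boolP (b \in V1).
  + rewrite (glued_cut gl aV aV2) (glued_cut gl bV bV2); exact: connect0.
  + by move: cab; rewrite (glued_cut gl aV aV2); apply: cross.
  + rewrite conn_sym; move: cab; rewrite (glued_cut gl bV bV2) conn_sym.
    exact: cross.
  + by rewrite (heq (a, k) (b, k)) //; exact: connect0.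
- have /subsetP abV : [set a; b] \subset V1.
    by case: gl => _ _ + _; apply; rewrite -(in_lift _ _ k) s1.
  rewrite !hx ?abV ?set21 ?set22 //.
  by apply: connect1; rewrite /step /= eqxx ab.
Qed.

Lemma conn_through_cut V1 V2 u F1 F2 T w1 w2 x y i j : glued V1 V2 u F1 F2 ->
  w1 \subset lift F1 -> w2 \subset lift F2 -> x \in V1 -> y \in V2 ->
  conn T (w1 :|: w2) (x, i) (y, j) ->
  conn T w1 (x, i) (u, false) || conn T w1 (x, i) (u, true).
Proof.
move=> gl /subsetP s1 /subsetP s2 xV yV cxy; apply/negPn/negP; rewrite negb_or.
case/andP=> nf nt.
(* If this set contains no copy of [u], then no open edge or post leaves it. *)
pose P a := (a.1 \in V1) && conn T w1 (x, i) a.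
suff /(_ _ _ cxy) : forall a b, conn T (w1 :|: w2) a b -> P a -> P b.
  rewrite /P /= xV [conn _ _ _ (x, i)]connect0 => /(_ isT)/andP[y1].
  by rewrite (glued_cut gl y1 yV); case: (j) nf nt => nf nt; apply/negP.
apply: conn_closed => -[a k] [b l]; rewrite {1}/step /= inE /P /=.
case/orP=> [/andP[/eqP<-{l} /orP[]] ab | /and3P[/eqP<- kl aT]] /andP[aV xa].
- have /subsetP abV : [set a; b] \subset V1.
    by case: gl => _ _ + _; apply; rewrite -(in_lift _ _ k) s1.
  rewrite abV ?set22 //=; apply: conn_trans xa _.
  by apply: connect1; rewrite /step /= eqxx ab.
- have /subsetP abV : [set a; b] \subset V2.
    by case: gl => _ _ _; apply; rewrite -(in_lift _ _ k) s2.
  move: xa; rewrite (glued_cut gl aV (abV a (set21 a b))).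
  by case: (k); rewrite ?(negbTE nf) ?(negbTE nt).
- by rewrite aV; apply: conn_trans xa (conn_post_eq _ _ _ aT).
Qed.

Variables (R : realFieldType) (p : {set V} -> R).

Lemma liftU F1 F2 : lift (F1 :|: F2) = lift F1 :|: lift F2.
Proof. by apply/setP=> -[e i]; rewrite in_setU !in_lift in_setU. Qed.

Lemma lift_disjoint F1 F2 : [disjoint F1 & F2] -> [disjoint lift F1 & lift F2].
Proof.
rewrite -!setI_eq0 => /eqP d; apply/eqP/setP=> -[e i].
by rewrite inE !in_lift -in_setI d !inE.
Qed.

Lemma gap_union F1 F2 T v x : [disjoint F1 & F2] ->
  gap p (F1 :|: F2) T v x =
  Ex (law p) (lift F1) (fun w1 => Ex (law p) (lift F2) (fun w2 =>
    diff R T (w1 :|: w2) v x)).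
Proof. by move=> d; rewrite /gap liftU ExU ?lift_disjoint. Qed.

(** Once the configuration on [F2] is fixed, the conditional expectation is the gap of [F1] with
    posts [add_post T w2 u]. *)
Lemma gap_glued_same V1 V2 u F1 F2 T v x :
  glued V1 V2 u F1 F2 -> [disjoint F1 & F2] -> v \in V1 -> x \in V1 ->
  (forall e, e \in F2 -> 0 <= p e <= 1) ->
  (forall T', 0 <= gap p F1 T' v x) -> 0 <= gap p (F1 :|: F2) T v x.
Proof.
move=> gl d vV xV p01 IH; rewrite setUC gap_union 1?disjoint_sym //.
apply: Ex_ge0 => [[e i]|w2 s2]; first by rewrite in_lift; apply: p01.
have := IH (add_post T w2 u); congr (0 <= _).
by apply: eq_Ex => w1 s1; rewrite /diff setUC !(conn_glued _ _ _ gl s1 s2).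
Qed.

(** Once [w1] is fixed, the expectation over [F2] is [diff R T w1 v u] times [gap p F2 T u x]. This
    is checked according to which copies of [u] are reached from v_0. *)
Lemma gap_glued_opposite V1 V2 u F1 F2 T v x :
  glued V1 V2 u F1 F2 -> [disjoint F1 & F2] -> v \in V1 -> x \in V2 ->
  gap p (F1 :|: F2) T v x = gap p F1 T v u * gap p F2 T u x.
Proof.
move=> gl d vV xV; rewrite gap_union // [X in _ = X * _]/gap -ExMr.
have [uV1 uV2] := andP (cut_glued gl).
apply: eq_Ex => w1 s1.
have E k w2 : w2 \subset lift F2 -> conn T w1 (v, false) (u, k) ->
    diff R T (w1 :|: w2) v x =
    (conn (add_post T w1 u) w2 (u, k) (x, false))%:R
    - (conn (add_post T w1 u) w2 (u, k) (x, true))%:R.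
  move=> s2 c; rewrite /diff !(conn_eql _ (connUl _ c)) setUC.
  by rewrite !(conn_glued _ _ _ (gluedC gl) s2 s1).
rewrite {2}/diff.
have [c0|c0] := boolP (conn T w1 (v, false) (u, false));
  have [c1|c1] := boolP (conn T w1 (v, false) (u, true)).
(* Both copies are reached: [u] acts as a post, and the gap from a post vanishes. *)
- rewrite subrr mul0r -[RHS](@gap_post _ _ p F2 (u |: T) u x) ?setU11 //.
  apply: eq_Ex => w2 s2; rewrite (E false) // /add_post.
  by rewrite -(conn_eql _ c0) c1.
- rewrite subr0 mul1r; apply: eq_Ex => w2 s2; rewrite (E false) // /add_post.
  by rewrite -(conn_eql _ c0) (negbTE c1).
(* Only u_1 is reached: reflecting the far side alone moves the start to u_0 and exchanges x_0 with
   x_1, which gives the sign -1. *)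
- rewrite sub0r mulN1r -(Ex_flip _ _ set0) -ExN; apply: eq_Ex => w2 s2.
  rewrite (E true) ?flip_sub // /add_post.
  have -> : conn T w1 (u, false) (u, true) = false.
    by rewrite conn_sym -(conn_eql _ c1) (negbTE c0).
  by rewrite !(conn_flip0 _ _ _ _ _ s2) opprB.
(* Neither copy is reached, so v_0 is connected to no copy of [x]. *)
- rewrite subrr mul0r; have <- : Ex (law p) (lift F2) (fun=> 0) = 0.
    by rewrite /Ex big1 // => w2 _; rewrite mulr0.
  apply: eq_Ex => w2 s2; rewrite /diff.
  have no j : conn T (w1 :|: w2) (v, false) (x, j) = false.
    apply/negP => /(conn_through_cut gl s1 s2 vV xV).
    by rewrite (negbTE c0) (negbTE c1).
  by rewrite !no subrr.
Qed.

End Gluing.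

(** * Paths avoiding the posts *)

Section Arc.
Variables (V : finType).
Implicit Types (B F H : {set {set V}}) (T : {set V}) (w : {set {set V} * bool}).
Implicit Types (x y z v : V) (p : seq V).

Lemma set2_eq x y a b : [set x; y] = [set a; b] ->
  (x = a /\ y = b) \/ (x = b /\ y = a).
Proof.
move=> E; have := set22 a b; have := set21 a b; rewrite -E.
have := set22 x y; have := set21 x y; rewrite {1 2}E !inE.
by do 4![case/orP=> /eqP ?]; subst; auto.
Qed.

(** Position [k] of [p] is position [k.+1] of [v :: p], so this is edge number [k] of the path; the
    default [v] does not occur when [k < size p]. *)
Definition arc_edge v p k : {set V} := [set nth v (v :: p) k; nth v p k].

Definition arc_edges v p : {set {set V}} := [set arc_edge v p k | k : 'I_(size p)].

Lemma arc_edgesP v p e :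
  reflect (exists2 k, (k < size p)%N & e = arc_edge v p k) (e \in arc_edges v p).
Proof.
apply: (iffP imsetP) => [[k _ ->] | [k kp ->]]; first by exists k.
by exists (Ordinal kp).
Qed.

Lemma conn_arc_open T w v p i :
  (forall e, e \in arc_edges v p -> (e, i) \in w) -> conn T w (v, i) (last v p, i).
Proof.
move=> op; have : forall k, (k <= size p)%N -> conn T w (v, i) (nth v (v :: p) k, i).
  elim=> [|k IH] kp; first exact: connect0.
  apply: conn_trans (IH (ltnW kp)) _; apply: connect1.
  by rewrite /step /= eqxx op //; apply/arc_edgesP; exists k.
by move/(_ _ (leqnn _)); rewrite -last_nth.
Qed.

(** Inner vertices meet no post and no edge of [B], so what remains of a broken arc hangs off its
    two ends as dead ends. *)
Lemma conn_arc_broken B T v p w1 w2 i j :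
  uniq (v :: p) ->
  (forall x, x \in v :: p -> x != v -> x != last v p -> x \notin T) ->
  (forall x e, x \in v :: p -> x != v -> x != last v p -> e \in B -> x \notin e) ->
  w1 \subset lift (arc_edges v p) -> w2 \subset lift B ->
  (forall k, exists2 e, e \in arc_edges v p & (e, k) \notin w1) ->
  conn T (w1 :|: w2) (v, i) (last v p, j) = conn T w2 (v, i) (last v p, j).
Proof.
move=> up intT intB /subsetP s1 /subsetP s2 br; apply/idP/idP; last exact: connUr.
(* [m k] is the position of one closed edge of the arc at level [k]; there the arc is cut in two. *)
have {br} [m mp mP] : exists2 m : bool -> nat, forall k, (m k < size p)%N &
    forall k, (arc_edge v p (m k), k) \notin w1.
  have [_ /arc_edgesP[a ap ->] ea] := br false; have [_ /arc_edgesP[b bp ->] eb] := br true.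
  by exists (fun k : bool => if k then b else a) => -[].
pose s := v :: p.
(* [h] contracts the two pieces of the broken path at each level to its ends. *)
pose h (a : V * bool) := if a.1 \in s then
  (if (index a.1 s <= m a.2)%N then v else last v p, a.2) else a.
have hv k : h (v, k) = (v, k) by rewrite /h /= mem_head /= eqxx.
have hl k : h (last v p, k) = (last v p, k).
  rewrite /h mem_last; have -> : index (last v p) s = size p.
    by rewrite (last_nth v) index_uniq /=.
  by rewrite leqNgt mp.
have hid x k : ~~ [&& x \in v :: p, x != v & x != last v p] -> h (x, k) = (x, k).
  rewrite !negb_and !negbK => /or3P[xp | /eqP-> | /eqP->] //.
  by rewrite /h (negbTE xp).
rewrite -{2}(hv i) -{2}(hl j); apply: conn_homo => -[a k] [b l].
rewrite {1}/step /= inE.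
case/orP=> [/andP[/eqP<-{l} /orP[]] ab | /and3P[/eqP<- kl aT]]; last first.
- have na : ~~ [&& a \in v :: p, a != v & a != last v p].
    by apply: contraL aT => /and3P[]; apply: intT.
  by rewrite !hid //; apply: conn_post_eq.
- have abB : [set a; b] \in B by rewrite -(in_lift _ _ k) s2.
  have nB c : c \in [set a; b] -> ~~ [&& c \in v :: p, c != v & c != last v p].
    by apply: contraL => /and3P[ca cv cl]; apply: intB abB.
  by rewrite !hid ?nB ?set21 ?set22 //; apply: connect1; rewrite /step /= eqxx ab.
suff -> : h (a, k) = h (b, k) by exact: connect0.
have /arc_edgesP[n np E] : [set a; b] \in arc_edges v p by rewrite -(in_lift _ _ k) s1.
have nk : n != m k by apply: contraTneq ab => nk; rewrite E nk; apply: mP.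
have np' : (n < size (v :: p))%N by rewrite ltnS ltnW.
(* The ends of edge [n] have indices [n] and [n.+1]; they fall on different sides of the cut only
   for [n = m k], which is excluded. *)
have hE : h (nth v (v :: p) n, k) = h (nth v p n, k).
  rewrite /h -[nth v p n]/(nth v s n.+1) !mem_nth // !index_uniq //=.
  by rewrite [(n <= _)%N]leq_eqVlt (negbTE nk).
by case: (set2_eq E) => -[-> ->].
Qed.

Variables (R : realFieldType) (q : {set V} -> R).

(** With v_0 joined to x_0, the sum is negative only if both crossed connections hold and v_1 is not
    joined to x_1. But v_0 joined to both copies of [x] joins these together, so v_1 reaches both or
    neither. The other case is symmetric. *)
Lemma diff_flip_ge0 F T w v x :
  w \subset lift F -> conn T w (v, false) (x, false) || conn T w (v, true) (x, true) ->
  0 <= diff R T w v x + diff R T (flip set0 w) v x.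
Proof.
move=> wF; rewrite /diff !(conn_flip0 _ _ _ _ _ wF) /=.
set a := conn _ _ (v, false) (x, false); set b := conn _ _ (v, false) (x, true).
set c := conn _ _ (v, true) (x, true); set d := conn _ _ (v, true) (x, false).
have ab_cd : a -> b -> c = d.
  by move=> ha hb; apply/conn_eqr; rewrite conn_sym -(conn_eql _ ha).
have cd_ab : c -> d -> a = b.
  by move=> hc hd; apply/conn_eqr; rewrite -(conn_eql _ hd).
move: ab_cd cd_ab; case: a b c d => [] [] [] [] // ab_cd cd_ab _;
  try by [have := ab_cd isT isT | have := cd_ab isT isT].
all: by rewrite ?subrr ?subr0 ?sub0r ?addr0 ?add0r ?addNr ?addrN ?ler01 ?addr_ge0.
Qed.

Lemma gap_arc F T v p :
  (forall e, e \in F -> 0 <= q e <= 1) -> uniq (v :: p) -> arc_edges v p \subset F ->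
  (forall x, x \in v :: p -> x != v -> x != last v p -> x \notin T) ->
  (forall x e, x \in v :: p -> x != v -> x != last v p ->
     e \in F :\: arc_edges v p -> x \notin e) ->
  0 <= gap q (F :\: arc_edges v p) T v (last v p) -> 0 <= gap q F T v (last v p).
Proof.
move=> q01 up sA intT intF IH; set A := arc_edges v p in sA intF IH *; set x := last v p in intT intF IH *.
have lq01 H : H \subset F -> forall ei, ei \in lift H -> 0 <= law q ei <= 1.
  by move=> /subsetP sH [e i]; rewrite in_lift => /sH; apply: q01.
pose open i w := [forall e in A, (e, i) \in w].
pose good w := open false w || open true w.
have goodP w : good w -> conn T w (v, false) (x, false) || conn T w (v, true) (x, true).
  by case/orP=> /forall_inP /conn_arc_open c; apply/orP; [left | right]; apply: c.
have good_flip w : good (flip set0 w) = good w.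
  have oE i : open i (flip set0 w) = open (~~ i) w.
    apply: eq_forallb => e; rewrite inE /flip_edge /= disjoints_subset.
    by rewrite (_ : e \subset _) ?addbT //; apply/subsetP=> z; rewrite !inE.
  by rewrite /good !oE orbC.
have -> : gap q F T v x =
    Ex (law q) (lift F) (fun w => if good w then diff R T w v x else 0) +
    Ex (law q) (lift F) (fun w => if good w then 0 else diff R T w v x).
  rewrite -ExD; apply: eq_Ex => w _.
  by case: ifP; rewrite ?addr0 ?add0r.
apply: addr_ge0.
  (* Doubling the expectation pairs each [w] with its full reflection, under which [good] is
     invariant. *)
  rewrite -(pmulrn_lge0 _ (isT : (0 < 2)%N)) mulr2n -{2}(Ex_flip _ _ set0) -ExD.
  apply: Ex_ge0; first exact: lq01.
  move=> w wF; rewrite good_flip; case: ifP => [/goodP|_]; last by rewrite addr0.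
  by move=> c; rewrite (diff_flip_ge0 wF c).
(* Condition on the part [w1] on the arc, which alone decides whether [w] is [good]. *)
rewrite -{1}(setID F A) (setIidPr sA) liftU ExU; last first.
  by apply: lift_disjoint; rewrite disjoint_sym disjoints_subset setDE subsetIr.
apply: Ex_ge0; first exact: lq01.
move=> w1 s1; have [gw | gw] := boolP (good w1).
  apply: Ex_ge0 => [|w2 s2]; first by apply/lq01/subsetDl.
  suff -> : good (w1 :|: w2) by [].
  case/orP: gw => /forall_inP o; apply/orP; [left | right];
    by apply/forall_inP => e /o; rewrite inE => ->.
move: IH; congr (0 <= _); apply: eq_Ex => w2 s2; have s2' := subsetP s2.
have -> : good (w1 :|: w2) = false.
  apply: contraNF gw; case/orP => /forall_inP o; apply/orP; [left | right];
    apply/forall_inP => e eA; have := o e eA; rewrite inE => /orP[h|/s2'] //;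
    by rewrite in_lift inE eA.
have br k : exists2 e, e \in A & (e, k) \notin w1.
  move: gw; rewrite negb_or => /andP[o0 o1].
  by case: k; apply/exists_inP; rewrite -negb_forall_in.
by rewrite /diff !(conn_arc_broken _ _ up intT intF s1 s2 br).
Qed.
End Arc.

(** * Blocks of a cactus *)

Section Structure.
Variables (V : finType).
Implicit Types (F : {set {set V}}) (x y z u v c d : V) (s r p : seq V).

(** [next] wraps around. A list of two vertices gives a single edge, so that bridges and cycles are
    treated alike. *)
Definition cycle_seq_edges s : {set {set V}} := [set [set x; next s x] | x in s].

Lemma adj_sym F : symmetric (adj F).
Proof. by move=> x y; rewrite /adj setUC. Qed.

Lemma cycle_seq_edges_sub F s : cycle (adj F) s -> cycle_seq_edges s \subset F.
Proof. by move=> cs; apply/subsetP=> _ /imsetP[x xs ->]; apply: next_cycle cs xs. Qed.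

Lemma cycle_seq_degree s z : uniq s ->
  (#|[set e in cycle_seq_edges s | z \in e]| <= 2)%N.
Proof.
move=> us; apply: leq_trans (_ : #|[set [set z; next s z]; [set prev s z; z]]| <= _)%N.
  apply/subset_leq_card/subsetP => e; rewrite inE => /andP[/imsetP[x xs ->]].
  by rewrite !inE => /orP[] /eqP->; rewrite ?prev_next // eqxx ?orbT.
by rewrite cards2; case: (_ != _).
Qed.

(* The new cycle follows the path from [c] until it first returns to [s], at
   [d], and then goes back to [c] along [s]. *)
Lemma cycle_ear F s c c' : uniq s -> cycle (adj F) s ->
  c \in s -> c' \in s -> c != c' ->
  connect (adj (F :\: cycle_seq_edges s)) c c' ->
  exists s', exists2 d, [/\ uniq s', (2 < size s')%N & cycle (adj F) s'] &
    [/\ [&& c != d, c \in s, d \in s, c \in s' & d \in s']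
      & cycle_seq_edges s != cycle_seq_edges s'].
Proof.
move=> us cys cs c's cc' /connectP[p0 pe0 lp0].
have {p0 pe0 lp0} [p [pe up lp]] : exists p, [/\ path (adj (F :\: cycle_seq_edges s)) c p,
    uniq (c :: p) & c' = last c p].
  by case/shortenP: pe0 lp0 => p pe up _ lp; exists p.
have hp : has (mem s) p.
  apply/hasP; exists c' => //; move: cc'; rewrite lp.
  by case: (p) => [|y q] /=; rewrite ?eqxx // mem_last.
case: (split_find hp) pe up => d r p2 ds rs; rewrite cat_path => /andP[pe _].
rewrite -cat_cons cat_uniq => /andP[up _].
have /= /andP[cr ur] := up.
have cd : c != d by apply: contraNneq cr => ->; rewrite mem_rcons mem_head.
(* Rotate [s] to start at [d]; splitting the rest at [c] then yields the arc [a] leading from [d]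
   back to [c]. *)
have [i t Et] := rot_to ds.
have ut : uniq (d :: t) by rewrite -Et rot_uniq.
have ct : c \in t.
  by have := cs; rewrite -(mem_rot i) Et inE (negbTE cd).
have ts : {subset d :: t <= s} by move=> z; rewrite -Et mem_rot.
have : cycle (adj F) (d :: t) by rewrite -Et rot_cycle.
have nextd : next s d = head d t.
  rewrite -(next_rot i us) Et /=; case: (t) ct => //= a t' _; by rewrite eqxx.
case/splitPr: t / ct nextd Et ut ts => a b nextd Et ut ts.
rewrite /cycle rcons_cat -cat_rcons cat_path => /andP[pa _].
have subF : subrel (adj (F :\: cycle_seq_edges s)) (adj F).
  by move=> x y; rewrite /adj inE => /andP[].
have peF := sub_path subF pe.
exists (c :: r ++ d :: a); exists d; split.
- have uda : uniq (d :: a).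
    by apply: subseq_uniq ut; rewrite -cat_cons prefix_subseq.
  have das z : z \in d :: a -> z \in s.
    by move=> za; apply: ts; rewrite -cat_cons mem_cat za.
  rewrite cons_uniq mem_cat cat_uniq uda andbT negb_or -andbA; apply/and4P; split.
  + by apply: contra cr => cr; rewrite mem_rcons inE cr orbT.
  + move: ut; rewrite -cat_cons cat_uniq => /and3P[_ /hasPn h _].
    by apply: h; rewrite mem_head.
  + by move: ur; rewrite rcons_uniq => /andP[].
  + by apply/hasPn => z /das zs; apply: contra rs => zr; apply/hasP; exists z.
(* If [r] and [a] were both empty, the path would be the single edge [cd], which belongs to the old
   cycle and was removed. *)
- case: r {rs cr ur up peF} pe => [|y r] pe; last by rewrite /= size_cat addnS.
  case: a nextd {Et ut ts pa} => [|y a] nextd //.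
  move: pe; rewrite /= andbT /adj inE => /andP[/negP[]].
  by apply/imsetP; exists d; rewrite ?nextd //= setUC.
- by rewrite /= rcons_cat rcons_cons -cat_rcons cat_path peF last_rcons.
- by rewrite cd cs [d \in s]ds mem_head inE mem_cat mem_head !orbT.
(* The first edge of the path lies on the new cycle but not on the old one. *)
- apply: contraTneq pe => E; set h := head d (r ++ d :: a).
  have : [set c; h] \in cycle_seq_edges s.
    rewrite E; apply/imsetP; exists c; first exact: mem_head.
    by rewrite /h; case: (r) => [|? ?] /=; rewrite eqxx.
  by rewrite /h; case: (r) => [|y r'] /= h'; rewrite /adj inE h'.
Qed.

End Structure.

Section Cactus.
Variable G : sgraph.
Implicit Types (F : {set {set G}}) (x y z u v c d : G) (s r p : seq G).

Lemma is_cycle_seq s : uniq s -> (2 < size s)%N -> cycle (adj (edges G)) s ->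
  is_cycle ([set x in s], cycle_seq_edges s).
Proof.
move=> us s3 cs; split; first exact: cycle_seq_edges_sub.
case: s us s3 cs => // y p us s3 cs; set s := y :: p in us s3 cs *.
exists (size s), (fun i => nth y s i).
have fS (i : 'I_(size s)) : next s (nth y s i) = nth y s (ordS i).
  rewrite next_nth mem_nth // index_uniq //=.
  (* At the last index, [ordS] returns to 0 and [nth] runs off [p] onto its default [y], the first
     vertex. *)
  have := ltn_ord i; rewrite ltnS leq_eqVlt => /orP[/eqP->|ip].
    by rewrite modnn nth_default.
  by rewrite modn_small.
split=> //=.
- by move=> i j /eqP; rewrite nth_uniq // => /eqP /val_inj.
- apply/setP => x; rewrite inE; apply/idP/imsetP => [xs | [i _ ->]].
    have xi : (index x s < size s)%N by rewrite index_mem.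
    by exists (Ordinal xi); rewrite //= nth_index.
  exact: mem_nth.
- apply/setP => e; apply/imsetP/imsetP => [[x xs ->] | [_ /imsetP[i _ ->] ->]].
    have xi : (index x s < size s)%N by rewrite index_mem.
    exists [set Ordinal xi; ordS (Ordinal xi)]; first exact: imset_f.
    by rewrite imsetU1 imset_set1 -fS /= nth_index.
  exists (nth y s i); first exact: mem_nth.
  by rewrite imsetU1 imset_set1 -fS.
Qed.

(** Take any edge of [F]. If it is a bridge, its two ends serve. Otherwise it lies on a cycle, and a
    path outside that cycle between two of its vertices would create a second cycle sharing two
    vertices with it. *)
Lemma cactus_block F : cactus G -> F \subset edges G -> F != set0 ->
  exists s, [/\ uniq s, s != [::], cycle_seq_edges s \subset F &
    forall c d, c \in s -> d \in s ->
      connect (adj (F :\: cycle_seq_edges s)) c d -> c = d].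
Proof.
move=> [_ cac] FG /set0Pn[e eF].
have /cards2P[x [y [xy Ee]]] : #|e| == 2%N by rewrite (edges_card2 (subsetP FG _ eF)).
have [/connectP[p0 pe0 lp0] | nc] := boolP (connect (adj (F :\ e)) x y); last first.
  have Ec : cycle_seq_edges [:: x; y] = [set e].
    apply/setP => f; rewrite inE; apply/imsetP/eqP => [[z zs ->]|->]; last first.
      by exists x; rewrite ?mem_head //= eqxx.
    move: zs; rewrite !inE => /orP[] /eqP-> /=; rewrite eqxx //.
    by rewrite eq_sym (negbTE xy) setUC.
  exists [:: x; y]; split=> //; first by rewrite /= inE xy.
    by rewrite Ec sub1set.
  rewrite Ec => c d; rewrite !inE => /orP[] /eqP-> /orP[] /eqP-> //.
    by rewrite (negbTE nc).
  by rewrite (sym_connect_sym (@adj_sym _ _)) (negbTE nc).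
have {p0 pe0 lp0} [p [pe up lp]] : exists p, [/\ path (adj (F :\ e)) x p,
    uniq (x :: p) & y = last x p].
  by case/shortenP: pe0 lp0 => p pe up _ lp; exists p.
have p2 : (2 < size (x :: p))%N.
  case: p pe lp {up} => [|z [|? ?]] //=; first by move=> _ E; rewrite E eqxx in xy.
  by move=> + E; rewrite -E /adj -Ee setD11.
have cyc : cycle (adj F) (x :: p).
  rewrite /cycle rcons_path -lp adj_sym /adj -Ee eF andbT.
  by apply: sub_path pe => a b; rewrite /adj inE => /andP[].
have cycG s : cycle (adj F) s -> cycle (adj (edges G)) s.
  by apply: sub_cycle => a b; apply: (subsetP FG).
exists (x :: p); split=> //; first exact: cycle_seq_edges_sub.
move=> c d cs ds con; apply/eqP/negPn/negP => cd.
have [s' [d' [us' s3 cs'] [/and5P[cd' _ d's cs'2 d's'] /eqP nE]]] :=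
  cycle_ear up cyc cs ds cd con.
have ne : ([set z in x :: p], cycle_seq_edges (x :: p)) <>
    ([set z in s'], cycle_seq_edges s') by case=> _ /nE.
have := cac _ _ (is_cycle_seq up p2 (cycG _ cyc)) (is_cycle_seq us' s3 (cycG _ cs')) ne.
apply/negP; rewrite -ltnNge; apply/card_gt1P; exists c, d'.
by split=> //; rewrite in_setI !in_set; apply/andP.
Qed.

(** If [F] is more than one block [C], a component of [F :\: C] with an edge meets [C] in at most
    one vertex, and can be split off there. *)
Lemma cactus_degree_or_cut F : cactus G -> F \subset edges G ->
  (forall z, #|[set e in F | z \in e]| <= 2)%N \/
  exists V1 V2 u F1 F2, [/\ glued V1 V2 u F1 F2, F1 :|: F2 = F,
    [disjoint F1 & F2], F1 != set0 & F2 != set0].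
Proof.
move=> cac FG; have [->|/(cactus_block cac FG)] := eqVneq F set0.
  by left=> z; rewrite (_ : [set _ in _ | _] = set0) ?cards0 //; apply/setP=> e; rewrite !inE.
case=> s [us s0 CF sep]; case: s us s0 CF sep => [|c s] // us _ CF sep; set C := cycle_seq_edges _ in CF sep.
have [F0|/set0Pn[g gF]] := eqVneq (F :\: C) set0.
  left=> z; have -> : F = C.
    by apply/eqP; rewrite eqEsubset CF andbT -setD_eq0 F0.
  exact: cycle_seq_degree.
right; have gG : g \in edges G by apply: (subsetP FG); case/setDP: gF.
have edgeE e : e \in F -> exists x y, e = [set x; y].
  move=> /(subsetP FG)/edges_card2 e2.
  have /cards2P[x [y [_ ->]]] : #|e| == 2%N by rewrite e2.
  by exists x, y.
have [x0 [y0 Eg]] : exists x y, g = [set x; y] by apply: edgeE; case/setDP: gF.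
pose S := [set x | connect (adj (F :\: C)) x0 x].
(* If the component [S] misses the block, the default [c] is used: the two sides are then
   unconnected, and gluing at [c] is still valid. *)
pose u := head c [seq x <- c :: s | x \in S].
have uP x : x \in c :: s -> x \in S -> x = u.
  move=> xs xS; have : u \in [seq x <- c :: s | x \in S].
    have : x \in [seq x <- c :: s | x \in S] by rewrite mem_filter xS.
    by rewrite /u; case: [seq _ <- _ | _] => // a l _; apply: mem_head.
  rewrite mem_filter => /andP[uS us']; apply: sep => //.
  move: uS xS; rewrite !inE => uS xS; apply: connect_trans uS.
  by rewrite (sym_connect_sym (@adj_sym _ _)).
have Sclosed x y : [set x; y] \in F :\: C -> (x \in S) = (y \in S).
  move=> xy; have e : connect (adj (F :\: C)) x y by apply: connect1.
  rewrite !inE; apply/idP/idP => h; apply: connect_trans h _ => //.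
  by rewrite (sym_connect_sym (@adj_sym _ _)).
exists (u |: S), (u |: ~: S), u, [set e in F :\: C | e \subset S],
  (F :\: [set e in F :\: C | e \subset S]); split.
- split.
  + by rewrite setUACA setUid setUCr setUT.
  + by rewrite -setUIr setICr setU0.
  + by move=> e; rewrite !inE => /andP[_ eS]; apply: subset_trans eS (subsetUr _ _).
  (* An edge of [C] has its ends on the block, which meets [S] at most in [u]. An edge outside [C]
     not contained in [S] avoids [S], as [S] is a component. *)
  + move=> e /setDP[eF]; rewrite inE => nS; have [x [y Ee]] := edgeE e eF.
    rewrite Ee in eF nS *; apply/subsetP => z zxy; rewrite !inE.
    have [eC|eC] := boolP ([set x; y] \in C).
      have zs : z \in c :: s.
        case/imsetP: eC zxy => t ts ->; rewrite !inE => /orP[] /eqP -> //.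
        by rewrite -[_ || _]/(_ \in c :: s) mem_next.
      by have [/(uP z zs)->|] := boolP (z \in S); rewrite ?eqxx ?orbT // inE => ->; rewrite orbT.
    have eFC : [set x; y] \in F :\: C by rewrite inE eC.
    have := Sclosed _ _ eFC; move: nS; rewrite eFC /= subUset !sub1set.
    case: (boolP (y \in S)) => yS /=; first by move=> + xS; rewrite xS.
    move=> _ xS; move: zxy yS; rewrite !inE => /orP[] /eqP-> yS; apply/orP; right.
      by move: xS; rewrite inE => ->.
    exact: yS.
- set K := [set _ in _ | _]; have KF : K \subset F.
    by apply/subsetP => e; rewrite !inE => /andP[/andP[]].
  by rewrite -{2}(setID F K) (setIidPr KF).
- by rewrite disjoint_sym disjoints_subset setDE subsetIr.
- apply/set0Pn; exists g; rewrite inE gF Eg subUset !sub1set.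
  by rewrite Eg in gF; rewrite -(Sclosed _ _ gF) inE connect0.
- apply/set0Pn; exists [set c; next (c :: s) c].
  have h : [set c; next (c :: s) c] \in C by apply/imset_f/mem_head.
  by rewrite !inE h (subsetP CF).
Qed.

(** The two arc edges before and after [x] already exhaust its degree. *)
Lemma degree_interior F v p x e : (forall z, #|[set e in F | z \in e]| <= 2)%N ->
  uniq (v :: p) -> arc_edges v p \subset F -> x \in v :: p -> x != v -> x != last v p ->
  e \in F :\: arc_edges v p -> x \notin e.
Proof.
move=> deg up /subsetP sF xp xv xl /setDP[eF eA]; apply/negP => xe.
set s := v :: p in up xp; pose k := index x s.
have kx : nth v s k = x by rewrite nth_index.
have ks : (k < size s)%N by rewrite index_mem.
have k0 : (0 < k)%N by rewrite lt0n; apply: contraNneq xv => k0; rewrite -kx k0.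
have kp : (k < size p)%N.
  rewrite ltn_neqAle [(k <= _)%N]ks andbT; apply: contraNneq xl => kp.
  by rewrite -kx kp (last_nth v).
have e1A : arc_edge v p k.-1 \in arc_edges v p.
  by apply/arc_edgesP; exists k.-1 => //; apply: leq_ltn_trans kp; apply: leq_pred.
have e2A : arc_edge v p k \in arc_edges v p by apply/arc_edgesP; exists k.
have x1 : x \in arc_edge v p k.-1.
  by rewrite -kx -[in nth v s k](prednK k0) set22.
have x2 : x \in arc_edge v p k by rewrite -kx set21.
have k1s : (k.-1 < size s)%N by apply: leq_ltn_trans ks; apply: leq_pred.
have ne : arc_edge v p k.-1 != arc_edge v p k.
  apply/eqP => E; have : nth v p k \in arc_edge v p k.-1 by rewrite E set22.
  rewrite !inE -[nth v p k]/(nth v s k.+1) -[nth v p k.-1]/(nth v s k.-1.+1).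
  rewrite prednK // !nth_uniq // !gtn_eqF //.
  by rewrite ltnS leq_pred.
have := deg x; rewrite leqNgt => /negP[].
have <- : #|e |: [set arc_edge v p k.-1; arc_edge v p k]| = 3%N.
  rewrite cardsU1 cards2 ne !inE negb_or.
  by rewrite !(contraNneq _ eA) // => ->.
apply/subset_leq_card/subsetP => f; rewrite !inE.
by case/or3P => /eqP->; rewrite ?eF ?sF.
Qed.

(** * The induction on the number of edges *)

Variables (R : realFieldType) (q : {set G} -> R).

(** The induction runs over edge subsets of one fixed cactus, because deleting edges may disconnect
    the graph and so leave the class of cacti. *)
Lemma gap_ge0 F T v x : cactus G -> (forall e, e \in edges G -> 0 <= q e <= 1) ->
  F \subset edges G -> 0 <= gap q F T v x.
Proof.
move=> cac q01; move: {2}#|F|.+1 (ltnSn #|F|) => n.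
elim: n F T v x => // n IH F T v x Fn FG.
have q01F e : e \in F -> 0 <= q e <= 1 by move=> /(subsetP FG); apply: q01.
have [<-|vx] := eqVneq v x.
  apply: Ex_ge0 => [[e i]|w _]; first by rewrite in_lift; apply: q01F.
  by rewrite /diff [conn _ _ _ (v, false)]connect0; case: (conn _ _ _ _); rewrite ?subrr ?subr0.
have [deg|[V1 [V2 [u [F1 [F2 [gl FE dF F10 F20]]]]]]] := cactus_degree_or_cut cac FG.
  (* Walks that never enter [T] after their start: the set reached from [v] has its outer boundary
     in [T], so [gap_separated] applies when [x] is not in it. *)
  pose e x y := adj F x y && (y \notin T).
  have [xU|xU] := boolP (x \in [set y | connect e v y]); last first.
    rewrite (gap_separated _ _ _ xU) ?inE ?connect0 // => a b ab.
    rewrite !inE => va; apply: contraNT => bT.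
    by apply: connect_trans va (connect1 _); rewrite /e /adj ab.
  move: xU; rewrite inE => /connectP[p0 pe0 lp0].
  case/shortenP: pe0 lp0 => p pe up _ lp; rewrite lp in vx *.
  have sA : arc_edges v p \subset F.
    apply/subsetP => _ /arc_edgesP[k kp ->].
    by have /(_ k kp)/andP[] := pathP v pe.
  apply: gap_arc => //.
  - move=> z; rewrite inE => /orP[->//|zp] _ _.
    have {}pe := pathP v pe.
    have kp : (index z p < size p)%N by rewrite index_mem.
    by have /andP[_] := pe _ kp; rewrite nth_index.
  - by move=> z f; apply: degree_interior.
  - apply: IH; last exact: subset_trans (subsetDl _ _) FG.
    rewrite ltnS in Fn; apply: leq_trans Fn; apply/proper_card/properP.
    split; first exact: subsetDl.
    (* As [v] and [x] differ, the arc has an edge, and deleting it strictly decreases [F]. *)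
    have sp : (0 < size p)%N by case: (p) vx => //=; rewrite eqxx.
    have h : arc_edge v p 0 \in arc_edges v p by apply/arc_edgesP; exists 0%N.
    by exists (arc_edge v p 0); rewrite ?(subsetP sA) // inE h.
have small F' F'' : F' :|: F'' = F -> [disjoint F' & F''] -> F'' != set0 ->
    (#|F'| < n)%N /\ F' \subset edges G.
  move=> E d n0; rewrite -E in Fn FG; split; last exact: subset_trans (subsetUl _ _) FG.
  rewrite ltnS in Fn; apply: leq_trans Fn.
  by rewrite cardsU disjoint_setI0 // cards0 subn0 -addn1 leq_add2l card_gt0.
have [n1 G1] := small _ _ FE dF F20.
have [n2 G2] : (#|F2| < n)%N /\ F2 \subset edges G.
  by apply: small F10; rewrite ?[F2 :|: _]setUC // disjoint_sym.
have q01i F' : F' \subset edges G -> forall e, e \in F' -> 0 <= q e <= 1.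
  by move=> F'G e /(subsetP F'G); apply: q01.
rewrite -FE; have [v1|/(in_glued gl) v2] := boolP (v \in V1).
  have [x1|/(in_glued gl) x2] := boolP (x \in V1).
    by apply: (gap_glued_same _ gl) => // [|T']; [apply: q01i | apply: IH].
  by rewrite (gap_glued_opposite _ _ gl) // mulr_ge0 ?IH.
rewrite setUC; rewrite disjoint_sym in dF.
have [x2|/(in_glued (gluedC gl)) x1] := boolP (x \in V2).
  by apply: (gap_glued_same _ (gluedC gl)) => // [|T']; [apply: q01i | apply: IH].
by rewrite (gap_glued_opposite _ _ (gluedC gl)) // mulr_ge0 ?IH.
Qed.

End Cactus.

(** * Comparison with the percolation law *)

Section Bridge.
Variables (R : realType) (G : sgraph).
Implicit Types (T : {set G}) (w : {set {set G} * bool}) (S : {set {set G * bool}}).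
Implicit Types (e : {set G}).

Lemma mem_hedge e i (a : G * bool) : (a \in hedge e i) = (a.1 \in e) && (a.2 == i).
Proof.
apply/imsetP/andP => [[x xe ->] | [ae /eqP <-]] //.
by exists a.1 => //; case: a {ae}.
Qed.

Lemma hedge_set2 (x y : G) i : hedge [set x; y] i = [set (x, i); (y, i)].
Proof. by rewrite /hedge imsetU1 imset_set1. Qed.

Definition bunkbed_subgraph T w : {set {set G * bool}} :=
  [set hedge ei.1 ei.2 | ei in w] :|: [set post v | v in T].

(** A vertex of [e] is needed to read the level off [hedge e i]. A post is no such set, since it
    meets both levels. *)
Lemma hedge_subgraph T w e i : w \subset lift (edges G) -> e \in edges G ->
  (hedge e i \in bunkbed_subgraph T w) = ((e, i) \in w).
Proof.
move=> wG eG; have /card_gt0P[x xe] : (0 < #|e|)%N by rewrite (edges_card2 eG).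
apply/idP/idP => [|eiw]; last by rewrite inE; apply/orP; left; apply/imsetP; exists (e, i).
rewrite inE => /orP[/imsetP[[e' i'] ei'w /= E] | /imsetP[v _ E]].
  have /andP[_ /eqP ii'] : (x \in e') && (i == i').
    by rewrite -(mem_hedge e' i' (x, i)) -E mem_hedge xe /=.
  suff -> : e = e' by rewrite ii'.
  apply/setP => y; have := mem_hedge e i (y, i).
  by rewrite E mem_hedge /= ii' !eqxx !andbT.
have := set21 (v, false) (v, true); have := set22 (v, false) (v, true).
rewrite -[[set _; _]]/(post v) -E !mem_hedge /= => /andP[_ /eqP<-].
by rewrite andbF.
Qed.

Lemma post_subgraph T w v : w \subset lift (edges G) ->
  (post v \in bunkbed_subgraph T w) = (v \in T).
Proof.
move=> wG; rewrite inE; apply/orP/idP => [[/imsetP[[e i] _ E] | /imsetP[u uT E]] | vT].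
- have := set21 (v, false) (v, true); have := set22 (v, false) (v, true).
  rewrite -[[set _; _]]/(post v) E !mem_hedge /= => /andP[_ /eqP<-].
  by rewrite andbF.
- have := set21 (v, false) (v, true); rewrite -[[set _; _]]/(post v) E !inE.
  by rewrite !xpair_eqE andbF orbF andbT => /eqP->.
- by right; apply: imset_f.
Qed.

Lemma subgraph_adj T w a b : w \subset lift (edges G) ->
  adj (bunkbed_subgraph T w) a b = step T w a b.
Proof.
move=> wG; case: a b => [x i] [y j]; rewrite /step /=.
apply/idP/orP => [|[/andP[/eqP<- xy] | /and3P[/eqP<- ij xT]]].
- rewrite /adj inE => /orP[/imsetP[[e k] ekw /= E] | /imsetP[u uT E]].
    left; have /subsetP/(_ _ ekw) := wG; rewrite in_lift => /edges_card2/eqP/cards2P.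
    case=> [a [b [_ Ee]]]; move: E; rewrite Ee hedge_set2 => /set2_eq.
    by case=> -[[-> ->] [-> ->]]; rewrite eqxx ?[[set b; a]]setUC -Ee.
  right; move: E => /set2_eq[] [[-> ->] [-> ->]]; rewrite eqxx //.
- rewrite /adj -hedge_set2 hedge_subgraph //.
  by have /subsetP/(_ _ xy) := wG; rewrite in_lift.
- rewrite /adj -(_ : post x = [set (x, i); (x, j)]) ?post_subgraph //.
  by case: i j ij => [] [] // _; rewrite /post // setUC.
Qed.

(** [bunkbed_subgraph T] and [dec] are inverse bijections between configurations and the edge sets
    whose posts are exactly those of [T]; all other edge sets have probability 0. *)
Lemma prob_connected_Ex T (p : {set G} -> R) (a b : bunkbed G) :
  prob_connected T p a b =
  Ex (law p) (lift (edges G)) (fun w => (conn T w a b)%:R).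
Proof.
pose E := edges G.
pose dec (S : {set {set G * bool}}) := [set ei in lift E | hedge ei.1 ei.2 \in S].
pose good (S : {set {set G * bool}}) := [forall v : G, (post v \in S) == (v \in T)].
have enc_edges w : w \subset lift E -> bunkbed_subgraph T w \subset edges (bunkbed G).
  move=> /subsetP wE; apply: setUSS; apply/subsetP => f /imsetP.
    case=> -[e i] /wE; rewrite in_lift => eE ->.
    by apply/imset2P; exists e i.
  by case=> v _ ->; apply: imset_f.
have encK w : w \subset lift E -> dec (bunkbed_subgraph T w) = w.
  move=> wE; apply/setP => -[e i]; rewrite inE in_lift /=.
  have [eE|eE] := boolP (e \in E); first by rewrite hedge_subgraph.
  by apply/esym/negbTE; apply: contra eE => /(subsetP wE); rewrite in_lift.
have decK S : S \subset edges (bunkbed G) -> good S -> bunkbed_subgraph T (dec S) = S.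
  move=> /subsetP SB /forallP gS; apply/setP => f; rewrite inE.
  apply/orP/idP => [[/imsetP[ei + ->] | /imsetP[v vT ->]] | fS].
  - by rewrite inE => /andP[].
  - by rewrite (eqP (gS v)).
  have := SB _ fS; rewrite inE => /orP[/imset2P[e i eE _ Ef] | /imsetP[v _ Ef]].
    left; apply/imsetP; exists (e, i) => //.
    by rewrite inE in_lift eE /= -Ef.
  by right; rewrite Ef; apply: imset_f; rewrite -(eqP (gS v)) -Ef.
rewrite /prob_connected /Ex big_mkcondr /=.
transitivity (\sum_(S in powerset (edges (bunkbed G)) | good S)
    (if reachable S a b then percolation_law T p S else 0)).
  rewrite [RHS]big_mkcondr /=; apply: eq_bigr => S _.
  by rewrite /percolation_law -/(good S); case: (good S); rewrite ?if_same.
rewrite (reindex_onto (bunkbed_subgraph T) dec) /=; last first.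
  by move=> S /andP[SB gS]; apply: decK; rewrite // -powersetE.
apply: eq_big => [w | w /andP[/andP[_ gw] /eqP dw]].
  apply/andP/idP => [[_ /eqP <-] | wE].
    by apply/subsetP => ei; rewrite inE => /andP[].
  rewrite powersetE enc_edges // encK // eqxx; split=> //.
  by apply/forallP => v; rewrite post_subgraph.
have wE : w \subset lift E by rewrite -dw; apply/subsetP => ei; rewrite inE => /andP[].
rewrite /reachable (eq_connect (fun c d => subgraph_adj T c d wE)) -/(conn T w a b).
case: (conn T w a b); rewrite ?mulr0 // mulr1 /percolation_law -/(good _) gw.
rewrite pair_big /wt; apply: eq_big => [[e i]|[e i] /andP[/= eE _]].
  by rewrite in_lift andbT.
by rewrite hedge_subgraph.
Qed.

End Bridge.

Theorem theorem2 (R : realType) (G : sgraph) :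
  cactus G -> strong_bunkbed R G.
Proof.
move=> cac T p v x p01; rewrite /bunkbed_statement !prob_connected_Ex -subr_ge0.
rewrite -ExN -ExD; exact: gap_ge0.
Qed.
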